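(* Let $n\ge 3$ be an integer and let $m_2(n)$ denote the maximum number of dominating sets of size $2$ in a graph on $n$ vertices with domination number $2$. Then $m_2(n)=\binom{n}{2}$ when $n$ is even, and $m_2(n)=\binom{n}{2}-1$ when $n$ is odd.
   Context: Graphs are finite and simple. A dominating set of a graph $G=(V,E)$ is a set $U\subseteq V$ such that each $x\in V\setminus U$ is adjacent to some $y\in U$. The domination number of $G$ is the smallest cardinality of a dominating set of $G$. *)

(* Defs.v *)
From HB Require Import structures.
From mathcomp Require Import all_boot.
Set Implicit Arguments.
Unset Strict Implicit.
Unset Printing Implicit Defensive.

Record sgraph (V : finType) := SGraph {
  edges : {set {set V}};
  edges_card2 : [forall e in edges, #|e| == 2]
}.

HB.instance Definition _ (V : finType) := [isSub for @edges V].
HB.instance Definition _ (V : finType) := [Finite of sgraph V by <:].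

(* Irreflexive, since [set x; x] has cardinality 1. *)
Definition adj (V : finType) (G : sgraph V) : rel V :=
  fun x y => [set x; y] \in edges G.

Definition dominating (V : finType) (G : sgraph V) (U : {set V}) : bool :=
  [forall x in ~: U, exists y in U, adj G x y].

(* The full vertex set, always dominating, is the default witness required by
   arg min. *)
Definition domination_number (V : finType) (G : sgraph V) : nat :=
  #|[arg min_(U < [set: V] | dominating G U) #|U|]|.

Definition dominating_sets (V : finType) (G : sgraph V) (k : nat) :
    {set {set V}} :=
  [set U : {set V} | dominating G U & #|U| == k].

(* \max over an empty family is 0, but the family is nonempty for n >= 2: take
   a complete graph on n - 1 vertices together with an isolated vertex. *)
Definition m2 (n : nat) : nat :=
  \max_(G : sgraph 'I_n | domination_number G == 2) #|dominating_sets G 2|.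

(* Main.v *)
Require Import Defs.
From HB Require Import structures.
From mathcomp Require Import all_boot.
From mathcomp Require Import zify.
Set Implicit Arguments.
Unset Strict Implicit.
Unset Printing Implicit Defensive.

(** In a graph with domination number 2 every vertex has a non-neighbour, and if
    y and z are two non-neighbours of x then {y, z} does not dominate x. Hence
    all pairs dominate only if the complement is a perfect matching, which forces
    n to be even. The extremal graphs are the complements of a perfect matching
    (n even) and of a matching plus a path on three vertices (n odd); in the
    latter only the two ends of the path fail to dominate. *)

Lemma set2_eq (T : finType) (a b c d : T) :
  [set a; b] = [set c; d] -> (a = c /\ b = d) \/ (a = d /\ b = c).
Proof.
move=> E; have /set2P ha : a \in [set c; d] by rewrite -E set21.
have /set2P hb : b \in [set c; d] by rewrite -E set22.
have /set2P hc : c \in [set a; b] by rewrite E set21.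
have /set2P hd : d \in [set a; b] by rewrite E set22.
by intuition congruence.
Qed.

(** Every orbit of [f] is a pair {x, f x} of two distinct points, so [T] splits into blocks of size
    2. *)
Lemma even_card_involution (T : finType) (f : T -> T) :
  involutive f -> (forall x, f x != x) -> ~~ odd #|T|.
Proof.
move=> ff fx.
have /fcard_order_set <- : T \subset order_set f 2.
- apply/subsetP => x _; rewrite !inE; apply/eqP.
  have -> : order f x = #|[set x; f x]|; last by rewrite cards2 eq_sym fx.
  apply: eq_card => y; rewrite !inE.
  apply/idP/idP => [/iter_findex <-|/orP[]/eqP->].
  + elim: (findex f x y) => [|k]; first by rewrite /= eqxx.
    by rewrite iterS => /orP[]/eqP->; rewrite ?ff eqxx ?orbT.
  + exact: connect0.
  + exact: fconnect1.
- by rewrite oddM andbF.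
- exact: inv_inj.
- by [].
Qed.

Section Domination.
Variables (V : finType) (G : sgraph V).
Implicit Types (U : {set V}) (x y : V).

Lemma adj_sym x y : adj G x y = adj G y x.
Proof. by rewrite /adj setUC. Qed.

Lemma dominatingP U :
  reflect (forall x, x \notin U -> exists2 y, y \in U & adj G x y)
          (dominating G U).
Proof.
apply: (iffP forall_inP) => h x; last by rewrite inE => /h/exists_inP.
by move=> xU; apply/exists_inP/h; rewrite inE.
Qed.

Lemma dominating_setT : dominating G [set: V].
Proof. by apply/dominatingP => x; rewrite inE. Qed.

Lemma domination_number_min U :
  dominating G U -> domination_number G <= #|U|.
Proof.
rewrite /domination_number => dU.
by case: arg_minnP; [exact: dominating_setT | move=> W _; apply].
Qed.

Lemma domination_number_attained :
  exists2 U, dominating G U & #|U| = domination_number G.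
Proof.
rewrite /domination_number.
by case: arg_minnP => [|W dW _]; [exact: dominating_setT | exists W].
Qed.

(** Otherwise {x} alone would dominate. *)
Lemma exists_nonadj x :
  1 < domination_number G -> exists2 y, y != x & ~~ adj G x y.
Proof.
move=> dom; apply/exists_inP; apply: contraLR dom.
rewrite negb_exists_in -leqNgt => /forall_inP h; rewrite -(cards1 x).
apply/domination_number_min/dominatingP => y; rewrite inE => yx.
by exists x; rewrite ?inE // adj_sym; move/negbNE: (h y yx).
Qed.

(** A singleton {x} misses the non-neighbour of [x], and the empty set misses [x0]. *)
Lemma domination_number_gt1 x0 :
  (forall x, exists2 y, y != x & ~~ adj G x y) -> 1 < domination_number G.
Proof.
move=> h; have [U /dominatingP dU <-] := domination_number_attained.
rewrite ltnNge; apply/negP; rewrite leq_eqVlt ltnS leqn0.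
case/orP=> [/cards1P[x eU]|].
- have [y yx /negP[]] := h x; have [|z] := dU y; first by rewrite eU inE.
  by rewrite eU inE => /eqP->; rewrite adj_sym.
- by rewrite cards_eq0 => /eqP U0; have [|z] := dU x0; rewrite U0 inE.
Qed.

Lemma dominating_sets_sub k :
  dominating_sets G k \subset [set U : {set V} | #|U| == k].
Proof. by apply/subsetP => U; rewrite !inE => /andP[]. Qed.

Lemma card_dominating_sets_le k : #|dominating_sets G k| <= 'C(#|V|, k).
Proof. by rewrite -card_draws; apply/subset_leq_card/dominating_sets_sub. Qed.

(** Sending each vertex to its only non-neighbour is an involution without fixed points. *)
Lemma all_pairs_dominate_even :
  1 < domination_number G ->
  (forall U, #|U| = 2 -> dominating G U) -> ~~ odd #|V|.
Proof.
move=> dom all2.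
have nb x : exists y, (y != x) && ~~ adj G x y.
  by have [y yx xy] := exists_nonadj x dom; exists y; rewrite yx.
pose f x := xchoose (nb x).
have fP x : f x != x /\ ~~ adj G x (f x) by apply/andP/(xchooseP (nb x)).
have uniq_nb x y z :
    y != x -> ~~ adj G x y -> z != x -> ~~ adj G x z -> y = z.
  move=> yx xy zx xz; apply/eqP; apply: contraT => yz.
  have /dominatingP/(_ x) : dominating G [set y; z].
    by apply: all2; rewrite cards2 yz.
  rewrite !inE ![x == _]eq_sym (negbTE yx) (negbTE zx) => /(_ isT)[w].
  by rewrite !inE => /orP[]/eqP->; rewrite ?(negbTE xy) ?(negbTE xz).
apply: (even_card_involution (f := f)) => x; last by case: (fP x).
have [fx xfx] := fP x; have [ffx fxffx] := fP (f x).
by apply: (uniq_nb (f x)); rewrite // 1?eq_sym 1?adj_sym.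
Qed.

Lemma card_dominating_sets2_odd :
  1 < domination_number G -> odd #|V| ->
  #|dominating_sets G 2| <= 'C(#|V|, 2) - 1.
Proof.
move=> dom oddV; rewrite subn1 -ltnS.
have lt : #|dominating_sets G 2| < 'C(#|V|, 2).
  rewrite ltn_neqAle card_dominating_sets_le andbT.
  apply: contraL oddV => /eqP eqC; apply: all_pairs_dominate_even => // U U2.
  (* Equal cardinality turns the inclusion into an equality, so every pair would dominate. *)
  have /eqP/setP/(_ U) : dominating_sets G 2 == [set U : {set V} | #|U| == 2].
    by rewrite eqEcard dominating_sets_sub card_draws eqC leqnn.
  by rewrite !inE U2 eqxx andbT.
(* [lt] makes the binomial positive, so its truncated predecessor is a genuine one. *)
by rewrite (ltn_predK lt).
Qed.

End Domination.

Lemma sgraph_of_rel (V : finType) (e : rel V) :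
  symmetric e -> irreflexive e -> exists G : sgraph V, adj G =2 e.
Proof.
move=> esym eirr.
pose E := [set [set p.1; p.2] | p in [set p : V * V | e p.1 p.2]].
have E2 : [forall A in E, #|A| == 2].
  apply/forall_inP => A /imsetP[[x y]]; rewrite inE /= => exy ->.
  by rewrite cards2; case: (eqVneq x y) exy => // ->; rewrite eirr.
exists (SGraph E2) => x y; apply/imsetP/idP => [[[a b]]|exy].
- by rewrite inE /= => ab /set2_eq[] [-> ->] //; rewrite esym.
- by exists (x, y); rewrite ?inE.
Qed.

(* The second disjunct only matters for odd n, where it attaches the unmatched
   vertex n - 1 to n - 2. *)
Definition near_matching (n : nat) : rel 'I_n :=
  fun x y => (x != y) && ((x./2 == y./2) || (n - 2 <= x) && (n - 2 <= y)).

(** An odd [x] is matched to x - 1 and an even [x] to x + 1; if x + 1 is out of range, then x = n -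
    1 is joined to n - 2. In the complement this gives each vertex a non-neighbour. *)
Lemma near_matching_total (n : nat) (x : 'I_n) :
  1 < n -> exists y : 'I_n, near_matching x y.
Proof.
move=> n1.
have [k kn] : exists2 k, k < n & (nat_of_ord x != k)
    && ((x./2 == k./2) || (n - 2 <= x) && (n - 2 <= k)).
  have := ltn_ord x; have := odd_double_half x; case: (odd x) => /= xE xn.
  - by exists x.-1; lia.
  - by case: (ltnP x.+1 n) => h; [exists x.+1 | exists x.-1]; lia.
by exists (Ordinal kn).
Qed.

(** Only the middle n - 2 of the path, present for odd [n], has two partners: the ends n - 3 and n -
    1. *)
Lemma near_matching_two (n : nat) (x y z : 'I_n) :
  near_matching z x -> near_matching z y -> x < y ->
  [/\ odd n, x = n - 3 :> nat & y = n.-1 :> nat].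
Proof.
rewrite /near_matching -!val_eqE /=.
have := (ltn_ord x, ltn_ord y, ltn_ord z) => -[[xn yn] zn].
by move=> h1 h2 h3; split; lia.
Qed.

(** The graph is the complement of [near_matching]. The boolean [odd n], read as 0 or 1, treats both
    parities at once. *)
Lemma m2_witness (n : nat) : 2 < n ->
  exists2 G : sgraph 'I_n, domination_number G = 2 &
    'C(n, 2) - odd n <= #|dominating_sets G 2|.
Proof.
case: n => [|[|[|n]]] // _; set N := n.+3.
have nsym : symmetric (@near_matching N).
  by move=> x y; rewrite /near_matching eq_sym [x./2 == _]eq_sym [(_ <= x) && _]andbC.
pose e : rel 'I_N := fun x y => (x != y) && ~~ near_matching x y.
have esym : symmetric e by move=> x y; rewrite /e eq_sym nsym.
have eirr : irreflexive e by move=> x; rewrite /e eqxx.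
have [G adjG] := sgraph_of_rel esym eirr; rewrite /e in adjG.
(* The ends N - 3 and N - 1 of the path. *)
pose a : 'I_N := inord n; pose b : 'I_N := ord_max.
(* A vertex outside {x, y} is undominated only if it is matched to both [x] and [y], which forces
   {x, y} = {a, b} and [N] odd. *)
have dom2 (x y : 'I_N) :
    x < y -> [set x; y] != [set a; b] \/ ~~ odd N -> dominating G [set x; y].
  move=> xy ab; apply/dominatingP => z; rewrite !inE negb_or => /andP[zx zy].
  have [zx'|zx'] := boolP (near_matching z x); last first.
    by exists x; rewrite ?set21 // adjG zx.
  exists y; rewrite ?set22 // adjG zy /=; apply/negP => zy'.
  have [oN xE yE] := near_matching_two zx' zy' xy.
  case: ab => [/eqP[]|]; last by rewrite oN.
  have -> : x = a by apply/val_inj; rewrite /= inordK //; lia.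
  by have -> : y = b by apply/val_inj.
have pair (U : {set 'I_N}) : #|U| == 2 -> exists x y : 'I_N, x < y /\ U = [set x; y].
  case/cards2P=> x [y [xy ->]].
  case: (ltngtP x y) => [h|h|h]; [by exists x, y| |by move/val_inj: h xy => ->; rewrite eqxx].
  by exists y, x; rewrite setUC.
(* The elements of {0, 1} differ by 1 and those of {a, b} by 2, so this pair dominates for either
   parity. *)
have dom : dominating G [set ord0; inord 1].
  apply: dom2; first by rewrite inordK.
  left; apply/eqP => /set2_eq[] [/(congr1 val)/= h1 /(congr1 val)/= h2];
    by move: h1 h2; rewrite !inordK //; lia.
exists G.
  apply/eqP; rewrite eqn_leq; apply/andP; split.
    apply: leq_trans (domination_number_min dom) _.
    by rewrite cards2; case: (_ != _).
  apply: (domination_number_gt1 ord0) => x.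
  have [y xy] := @near_matching_total N x isT.
  by exists y; [rewrite eq_sym; case/andP: xy | rewrite adjG xy andbF].
rewrite -[X in 'C(X, 2)](card_ord N) -card_draws.
case oN: (odd N); last first.
  rewrite subn0; apply/subset_leq_card/subsetP => U; rewrite !inE => U2.
  by rewrite U2 andbT; have [x [y [xy ->]]] := pair U U2; apply: dom2; rewrite ?oN; auto.
(* The pair {a, b} accounts for the subtracted 1; all other pairs dominate. *)
rewrite leq_subLR (cardsD1 [set a; b]); apply: leq_add; first exact: leq_b1.
apply/subset_leq_card/subsetP => U; rewrite !inE => /andP[Uab U2].
rewrite U2 andbT; have [x [y [xy UE]]] := pair U U2.
by rewrite UE in Uab *; apply: dom2; auto.
Qed.

Theorem proposition2p2 (n : nat) (hn : 3 <= n) :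
  (~~ odd n -> m2 n = 'C(n, 2)) /\ (odd n -> m2 n = 'C(n, 2) - 1).
Proof.
have [G domG cardG] := m2_witness hn.
have lower : 'C(n, 2) - odd n <= m2 n.
  apply: leq_trans cardG _; rewrite /m2.
  by apply: (leq_bigmax_cond (F := fun G => #|dominating_sets G 2|)); apply/eqP.
(* The upper bound is the number of all pairs for even [n], and the parity obstruction removes one
   for odd [n]. *)
split=> oN; apply/eqP; rewrite eqn_leq.
- apply/andP; split; last by rewrite (negbTE oN) subn0 in lower.
  by apply/bigmax_leqP => H _; rewrite -[n in 'C(n, 2)]card_ord card_dominating_sets_le.
- apply/andP; split; last by rewrite oN in lower.
  apply/bigmax_leqP => H /eqP domH; rewrite -[n in 'C(n, 2)]card_ord.
  by apply: card_dominating_sets2_odd; rewrite ?domH ?card_ord.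
Qed.
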